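(* For every integer $n\ge 1$, there is a bijection between the set of isomorphism classes of unbalanced $XY$-graphs on $n$ vertices and the set of isomorphism classes of $XY$-graphs (balanced or unbalanced) on $t$ vertices, where $t$ ranges over $0\le t\le n-1$.
   Context: An $XY$-graph is a bipartite graph together with a specified ordered bipartition $X\cup Y$ of its vertex set (every edge joins $X$ to $Y$; either part may be empty); isomorphisms of $XY$-graphs must map $X$ onto $X'$ and $Y$ onto $Y'$. A vertex of $Y$ is an isolate if it has no neighbor; a vertex of $X$ is universal if it is adjacent to every vertex of $Y$. Balance is defined only for $XY$-graphs with no isolates in $Y$: such an $XY$-graph is unbalanced if $X$ contains a universal vertex and balanced otherwise. Thus ''balanced or unbalanced $XY$-graph'' means an $XY$-graph with no isolates in $Y$. *)

(* Defs.v *)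
From HB Require Import structures.
From mathcomp Require Import all_boot.
Set Implicit Arguments. Unset Strict Implicit. Unset Printing Implicit Defensive.

(* The part Y is the complement of [xpart] (see [ypart]); either may be empty.
   Irreflexivity of [edge] follows from [edge_bip]. *)
Record xygraph := XYGraph {
  vertex :> finType;
  xpart : {set vertex};
  edge : rel vertex;
  edge_sym : symmetric edge;
  edge_bip : forall u v, edge u v -> (u \in xpart) != (v \in xpart) }.

Definition ypart (G : xygraph) : {set G} := ~: xpart G.

Definition isolate (G : xygraph) (y : G) : bool :=
  (y \in ypart G) && [forall v, ~~ edge y v].

Definition universal (G : xygraph) (x : G) : bool :=
  (x \in xpart G) && [forall (y | y \in ypart G), edge x y].

Definition no_isolates (G : xygraph) : bool := [forall y : G, ~~ isolate y].

Definition unbalanced (G : xygraph) : bool :=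
  no_isolates G && [exists x : G, universal x].

Definition balanced (G : xygraph) : bool :=
  no_isolates G && ~~ [exists x : G, universal x].

Definition xy_iso (G H : xygraph) : Prop :=
  exists f : G -> H,
    [/\ bijective f,
        forall u v, edge (f u) (f v) = edge u v,
        f @: xpart G = xpart H
      & f @: ypart G = ypart H].

(* Classes are plain predicates: [xygraph] is too large for the universe of
   mathcomp-classical's [set]. *)
Definition iso_class (G : xygraph) : xygraph -> Prop := fun H => xy_iso G H.

Definition iso_classes (P : xygraph -> Prop) : Type :=
  {C : xygraph -> Prop | exists2 G, P G & C = iso_class G}.

(* Main.v *)
(* An unbalanced graph on n vertices is obtained from a unique graph H on
   t <= n - 1 vertices without isolates in Y: add n - 1 - t isolates to Y, then
   a universal vertex to X.  Conversely, delete a universal vertex and the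
   isolates that this creates; the result does not depend on the universal
   vertex, since exchanging two universal vertices is an automorphism. *)
Require Import Defs.
From mathcomp Require Import all_boot perm.
From Stdlib Require Import ClassicalEpsilon FunctionalExtensionality
  PropExtensionality ProofIrrelevance.

Set Implicit Arguments.
Unset Strict Implicit.
Unset Printing Implicit Defensive.

(** * Isomorphisms and isomorphism classes *)

Lemma xy_iso_inj (G H : xygraph) (f : G -> H) :
    injective f -> #|H| <= #|G| ->
    (forall u v, edge (f u) (f v) = edge u v) ->
    (forall u, (f u \in xpart H) = (u \in xpart G)) ->
  xy_iso G H.
Proof.
move=> f_inj leHG f_edge f_x; have f_bij := inj_card_bij f_inj leHG.
have [g fK gK] := f_bij.
(* Both image conditions reduce to the pointwise condition on X, since Y is its complement. *)
exists f; split=> //; apply/setP=> v; rewrite -[v]gK mem_imset ?inE //.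
by rewrite f_x.
Qed.

Lemma xy_isoP (G H : xygraph) :
  xy_iso G H ->
  exists f : G -> H,
    [/\ bijective f, forall u v, edge (f u) (f v) = edge u v
      & forall u, (f u \in xpart H) = (u \in xpart G)].
Proof.
case=> f [f_bij f_edge fX _]; exists f; split=> // u.
by rewrite -fX mem_imset //; apply: bij_inj.
Qed.

Lemma xy_iso_refl (G : xygraph) : xy_iso G G.
Proof. by apply: (@xy_iso_inj G G id). Qed.

Lemma xy_iso_card (G H : xygraph) : xy_iso G H -> #|G| = #|H|.
Proof. by case=> f [/bij_eq_card]. Qed.

Lemma xy_iso_sym (G H : xygraph) : xy_iso G H -> xy_iso H G.
Proof.
move=> isoGH; have eqc := xy_iso_card isoGH.
have [f [[g fK gK] f_edge f_x]] := xy_isoP isoGH.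
apply: (@xy_iso_inj H G g); first exact: can_inj gK.
- by rewrite eqc.
- by move=> u v; rewrite -f_edge !gK.
- by move=> u; rewrite -f_x gK.
Qed.

Lemma xy_iso_trans (H G K : xygraph) : xy_iso G H -> xy_iso H K -> xy_iso G K.
Proof.
move=> isoGH isoHK; have eqc := etrans (xy_iso_card isoGH) (xy_iso_card isoHK).
have [f [/bij_inj f_inj f_edge f_x]] := xy_isoP isoGH.
have [g [/bij_inj g_inj g_edge g_x]] := xy_isoP isoHK.
apply: (@xy_iso_inj G K (g \o f)) => /=; first exact: inj_comp.
- by rewrite eqc.
- by move=> u v; rewrite g_edge f_edge.
- by move=> u; rewrite g_x f_x.
Qed.

Lemma iso_class_eq (G H : xygraph) : iso_class G = iso_class H <-> xy_iso G H.
Proof.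
split=> [eqGH | isoGH].
  have: iso_class H H by exact: xy_iso_refl.
  by rewrite -eqGH.
apply: functional_extensionality => K; apply: propositional_extensionality.
by split; apply: xy_iso_trans => //; apply: xy_iso_sym.
Qed.

Lemma iso_classes_inj (P : xygraph -> Prop) (C D : iso_classes P) :
  sval C = sval D -> C = D.
Proof.
case: C D => [C hC] [D hD] /= eqCD; rewrite eqCD in hC *.
by congr exist; apply: proof_irrelevance.
Qed.

(** [F] runs against the direction of [f], because adding vertices involves no choice while deleting
    a universal vertex does. Both [f] and its inverse act on chosen representatives; as [F]
    preserves and reflects isomorphism, the choices do not affect the classes. *)
Lemma iso_classes_bij (P Q : xygraph -> Prop) (F : xygraph -> xygraph) :
    (forall H, Q H -> P (F H)) ->
    (forall H K, Q H -> Q K -> xy_iso (F H) (F K) <-> xy_iso H K) ->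
    (forall G, P G -> exists2 H, Q H & xy_iso (F H) G) ->
  exists f : iso_classes P -> iso_classes Q, bijective f.
Proof.
move=> FP F_iso F_surj.
(* By surjectivity up to isomorphism, each class for [P] has a representative of the form [F H]. *)
have repP (C : iso_classes P) :
    {H : xygraph | Q H /\ sval C = iso_class (F H)}.
  apply: constructive_indefinite_description.
  case: C => C [G /F_surj[H QH isoG] defC] /=; exists H; split=> //.
  by rewrite defC; apply/iso_class_eq/xy_iso_sym.
have repQ (D : iso_classes Q) : {H : xygraph | Q H /\ sval D = iso_class H}.
  apply: constructive_indefinite_description.
  by case: D => D [H QH defD]; exists H.
pose f C : iso_classes Q := exist _ (iso_class (sval (repP C)))
  (ex_intro2 _ _ (sval (repP C)) (svalP (repP C)).1 erefl).
pose g D : iso_classes P := exist _ (iso_class (F (sval (repQ D))))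
  (ex_intro2 _ _ (F (sval (repQ D))) (FP _ (svalP (repQ D)).1) erefl).
exists f; exists g => [C | D]; apply: iso_classes_inj => /=.
- case: (repQ (f C)) => H [QH /=]; case: (repP C) => K [QK eqC] /= eqKH.
  by rewrite eqC; apply/iso_class_eq/F_iso => //; apply/xy_iso_sym/iso_class_eq.
- case: (repP (g D)) => H [QH /=]; case: (repQ D) => K [QK eqD] /= eqKH.
  rewrite eqD.
  by apply/iso_class_eq/F_iso => //; apply/xy_iso_sym/iso_class_eq.
Qed.

(** * Isolates and universal vertices *)

Lemma no_isolatesP (G : xygraph) :
  reflect (forall y, y \notin xpart G -> exists v, edge y v) (no_isolates G).
Proof.
apply: (iffP forallP) => [noG y yY | noG y].
  have := noG y; rewrite /isolate inE yY /= negb_forall => /existsP[v].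
  by rewrite negbK; exists v.
apply/negP=> /andP[]; rewrite inE => /noG[v yv] /forallP/(_ v).
by rewrite yv.
Qed.

Lemma universalP (G : xygraph) (x : G) :
  reflect (x \in xpart G /\ forall v, edge x v = (v \notin xpart G))
    (universal x).
Proof.
apply: (iffP andP) => -[xX uni]; split=> //.
  move=> v; apply/idP/idP=> [/edge_bip | vY]; first by rewrite xX; case: (v \in _).
  by have /forall_inP := uni; apply; rewrite inE.
by apply/forall_inP=> y; rewrite inE uni.
Qed.

(** Both vertices lie in X and have all of Y as neighborhood, so they are twins. *)
Lemma universal_swap (G : xygraph) (x x' : G) :
    universal x -> universal x' ->
  (forall u v, edge (tperm x x' u) (tperm x x' v) = edge u v) /\
  (forall u, (tperm x x' u \in xpart G) = (u \in xpart G)).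
Proof.
move=> /universalP[xX ux] /universalP[xX' ux'].
have tX u : (tperm x x' u \in xpart G) = (u \in xpart G).
  by case: tpermP => [->|->|]; rewrite ?xX ?xX'.
have tE u v : edge (tperm x x' u) v = edge u v.
  by case: tpermP => [->|->|]; rewrite ?ux ?ux'.
by split=> // u v; rewrite tE edge_sym tE edge_sym.
Qed.

(* What is left after deleting [x] and then the isolates of Y. *)
Definition core (G : xygraph) (x : G) : pred G :=
  fun v => (v != x) && ((v \in xpart G) || [exists w, (w != x) && edge v w]).

(** * Adding isolates and a universal vertex *)

Section Extension.

Variables (H : xygraph) (k : nat).

Local Notation ext_vertex := (option (H + 'I_k)).

(** [None] is the new universal vertex, [inl] carries the vertices of [H], and [inr] the [k] new
    vertices of Y, whose only neighbor will be [None]. *)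
Definition ext_xpart : {set ext_vertex} :=
  [set v | match v with
           | None => true
           | Some (inl h) => h \in xpart H
           | Some (inr _) => false
           end].

Definition ext_edge (u v : ext_vertex) : bool :=
  match u, v with
  | Some (inl a), Some (inl b) => edge a b
  | None, _ => v \notin ext_xpart
  | _, None => u \notin ext_xpart
  | _, _ => false
  end.

Lemma ext_edge_sym : symmetric ext_edge.
Proof. by move=> [[a|i]|] [[b|j]|] //=; rewrite edge_sym. Qed.

Lemma ext_edge_bip (u v : ext_vertex) :
  ext_edge u v -> (u \in ext_xpart) != (v \in ext_xpart).
Proof.
case: u v => [[a|i]|] [[b|j]|] //=; rewrite ?inE //;
  by [exact: edge_bip | case: (_ \in _)].
Qed.

Definition ext : xygraph := XYGraph ext_edge_sym ext_edge_bip.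

Lemma card_ext : #|ext| = (#|H| + k).+1.
Proof. by rewrite card_option card_sum card_ord. Qed.

Lemma ext_universal : universal (None : ext).
Proof. by apply/universalP; split=> [|v //]; first rewrite inE. Qed.

Lemma ext_unbalanced : unbalanced ext.
Proof.
apply/andP; split; last by apply/existsP; exists None; apply: ext_universal.
apply/no_isolatesP=> y yY; exists None; rewrite edge_sym.
by have /universalP[_ ->] := ext_universal.
Qed.

(** Without [None], the [k] added vertices of Y have no neighbor left, whereas each vertex of Y in
    [H] keeps a neighbor inside [H]. Hence [H] can be recovered from its extension. *)
Lemma ext_coreP (v : ext) : no_isolates H ->
  reflect (exists h : H, v = Some (inl h)) (core (None : ext) v).
Proof.
move=> /no_isolatesP noH; apply: (iffP idP) => [|[h ->{v}]].
  case: v => [[h|i]|] //; first by exists h.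
  by rewrite /core inE => /existsP[[[b|j]|]].
rewrite /core inE /=; case: (boolP (h \in xpart H)) => //= /noH[h' hh'].
by apply/existsP; exists (Some (inl h')).
Qed.

End Extension.

(** * Isomorphisms between extensions *)

Lemma ext_iso (H K : xygraph) (k : nat) :
  xy_iso H K -> xy_iso (ext H k) (ext K k).
Proof.
move=> isoHK; have eqc := xy_iso_card isoHK.
have [f [/bij_inj f_inj f_edge f_x]] := xy_isoP isoHK.
pose F (v : ext H k) : ext K k :=
  match v with
  | Some (inl h) => Some (inl (f h))
  | Some (inr i) => Some (inr i)
  | None => None
  end.
apply: (@xy_iso_inj _ _ F).
- by move=> [[a|i]|] [[b|j]|] //= [] => [/f_inj|] ->.
- by rewrite !card_ext eqc.
- by move=> [[a|i]|] [[b|j]|] //=; rewrite ?inE /= ?f_edge ?f_x.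
- by move=> [[a|i]|]; rewrite !inE /= ?f_x.
Qed.

(** The image of [None] is again universal, so composing with its transposition with [None] corrects
    the isomorphism. *)
Lemma ext_iso_fix_apex (H K : xygraph) (k l : nat) :
  xy_iso (ext H k) (ext K l) ->
  exists f : ext H k -> ext K l,
    [/\ bijective f, forall u v, edge (f u) (f v) = edge u v,
        forall u, (f u \in xpart (ext K l)) = (u \in xpart (ext H k))
      & f None = None].
Proof.
move=> /xy_isoP[f [f_bij f_edge f_x]].
have fN_universal : universal (f None).
  have [g fK gK] := f_bij.
  have /universalP[NX uN] := ext_universal H k.
  apply/universalP; split=> [|v]; first by rewrite f_x.
  by rewrite -[v]gK f_edge f_x uN.
have [tE tX] := universal_swap fN_universal (ext_universal K l).
exists (tperm (f None) None \o f); split=> [|u v|u|] /=.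
- by apply: bij_comp f_bij; exists (tperm (f None) None) => u; rewrite tpermK.
- exact: etrans (tE _ _) (f_edge _ _).
- exact: etrans (tX _) (f_x _).
- by rewrite tpermL.
Qed.

(** Membership in [core None] is expressed by X, adjacency and [None] alone, so an isomorphism
    fixing [None] preserves it, and the cores are the copies of [H] and [K]. *)
Lemma ext_iso_embedding (H K : xygraph) (k l : nat) :
    no_isolates H -> no_isolates K -> xy_iso (ext H k) (ext K l) ->
  exists f : H -> K,
    [/\ injective f, forall u v, edge (f u) (f v) = edge u v
      & forall u, (f u \in xpart K) = (u \in xpart H)].
Proof.
move=> noH noK /ext_iso_fix_apex[f [f_bij f_edge f_x fN]].
have f_inj := bij_inj f_bij.
have f_neq v : (f v != None) = (v != None) by rewrite -fN (inj_eq f_inj).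
have f_core h : exists h' : K, f (Some (inl h)) == Some (inl h').
  have : core (None : ext H k) (Some (inl h)) by apply/ext_coreP => //; exists h.
  rewrite /core => /andP[hN hc].
  have /(ext_coreP _ noK)[h' ->] : core (None : ext K l) (f (Some (inl h))).
    (* A neighbor [w] other than [None] is sent to a neighbor [f w] other than [None]. *)
    rewrite /core f_neq hN f_x andTb; case/orP: hc => [-> //|/existsP[w wP]].
    by apply/orP; right; apply/existsP; exists (f w); rewrite f_neq [X in _ && X]f_edge.
  by exists h'.
pose g h := xchoose (f_core h).
have gE h : f (Some (inl h)) = Some (inl (g h)).
  by apply/eqP; apply: (xchooseP (f_core h)).
exists g; split=> [a b eq_g | a b | a].
- by have /f_inj[] : f (Some (inl a)) = f (Some (inl b)) by rewrite !gE eq_g.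
- by have := f_edge (Some (inl a)) (Some (inl b)); rewrite !gE.
- by have := f_x (Some (inl a)); rewrite gE !inE.
Qed.

(** The isomorphism and its inverse give embeddings both ways; the second bounds the order of [K],
    so the first is bijective. *)
Lemma ext_iso_inv (H K : xygraph) (k l : nat) :
    no_isolates H -> no_isolates K ->
  xy_iso (ext H k) (ext K l) -> xy_iso H K.
Proof.
move=> noH noK isoE.
have [f [f_inj f_edge f_x]] := ext_iso_embedding noH noK isoE.
have [g [g_inj _ _]] := ext_iso_embedding noK noH (xy_iso_sym isoE).
by apply: (xy_iso_inj f_inj _ f_edge f_x); apply: leq_card g_inj.
Qed.

(** * Deleting a universal vertex and the isolates this creates *)

Section Induced.

Variables (G : xygraph) (P : pred G).

Definition induced_edge : rel {v : G | P v} := fun u v => edge (val u) (val v).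

Lemma induced_edge_sym : symmetric induced_edge.
Proof. by move=> u v; apply: edge_sym. Qed.

Lemma induced_edge_bip (u v : {v : G | P v}) :
  induced_edge u v ->
  (u \in [set w | val w \in xpart G]) != (v \in [set w | val w \in xpart G]).
Proof. by rewrite !inE; apply: edge_bip. Qed.

Definition induced : xygraph := XYGraph induced_edge_sym induced_edge_bip.

End Induced.

(** A vertex of Y in the core has a neighbor other than [x]; that neighbor lies in X, hence in the
    core too. *)
Lemma core_no_isolates (G : xygraph) (x : G) : no_isolates (induced (core x)).
Proof.
apply/no_isolatesP=> -[y yc]; rewrite inE /= => yY.
have := yc; rewrite /core (negPf yY) => /andP[_ /existsP[w /andP[wx yw]]].
have wc : core x w.
  by rewrite /core wx /=; have := edge_bip yw; rewrite (negPf yY); case: (w \in _).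
by exists (exist _ w wc).
Qed.

Lemma card_core_lt (G : xygraph) (x : G) : #|induced (core x)| < #|G|.
Proof.
rewrite card_sig; apply: proper_card; apply/properP.
split; first exact: subset_predT.
by exists x; rewrite // inE /core eqxx.
Qed.

(** The vertices outside the core and different from [x] lie in Y and see only [x], exactly like the
    added [inr] vertices; the cardinality hypothesis says that there are [k] of them. *)
Lemma ext_core_iso (G : xygraph) (x : G) (k : nat) :
    universal x -> #|G| = (#|induced (core x)| + k).+1 ->
  xy_iso (ext (induced (core x)) k) G.
Proof.
move=> /universalP[xX ux] cardG.
pose I := [predC [predU1 x & core x]].
have x_core : x \notin core x by rewrite unfold_in eqxx.
have cardI : k = #|I|.
  apply/eqP; rewrite -(eqn_add2l #|[predU1 x & core x]|) cardC cardG cardU1.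
  by rewrite x_core card_sig.
(* The [k] added vertices are matched with an enumeration of [I]. *)
pose F (v : ext (induced (core x)) k) : G :=
  match v with
  | Some (inl h) => val h
  | Some (inr i) => enum_val (cast_ord cardI i)
  | None => x
  end.
have FI i : F (Some (inr i)) \in I by apply: enum_valP.
have F_iso i : [/\ F (Some (inr i)) != x, F (Some (inr i)) \notin xpart G
    & forall w, edge (F (Some (inr i))) w = (w == x)].
  move: (FI i); set v := F _; rewrite !inE negb_or => /andP[vx].
  rewrite [v \in core x]unfold_in vx /= negb_or => /andP[vY /existsPn nov].
  split=> // w; apply/idP/eqP=> [vw | ->]; last by rewrite edge_sym ux.
  by have := nov w; rewrite vw andbT negbK => /eqP.
have F_x u : (F u \in xpart G) = (u \in xpart (ext (induced (core x)) k)).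
  by case: u => [[a|i]|]; rewrite !inE //=; case: (F_iso i) => _ /negPf.
have core_neq h : F (Some (inl h)) != x by case: h => h hc; case/andP: (hc).
have iso_neq i : F (Some (inr i)) != x by case: (F_iso i).
have neq_core h i : F (Some (inl h)) != F (Some (inr i)).
  apply/eqP=> eqF; move: (FI i); rewrite -eqF !inE /= negb_or.
  by case: h {eqF} => h hc /=; rewrite [h \in _]hc andbF.
apply: (@xy_iso_inj _ _ F) => //; last 1 first.
- move=> [[a|i]|] [[b|j]|] //.
  + by rewrite [LHS]edge_sym; case: (F_iso j) => _ _ ->; apply: negPf.
  + by rewrite [LHS]edge_sym ux F_x.
  + by case: (F_iso i) => _ _ ->; apply: negPf.
  + by case: (F_iso i) => _ _ ->; apply: negPf.
  + by case: (F_iso i) => _ _ ->; rewrite eqxx /edge /= inE.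
  + by rewrite [LHS]ux F_x.
  + by rewrite [LHS]ux F_x.
  + by rewrite [LHS]ux F_x.
- move=> [[a|i]|] [[b|j]|] //.
  + by move=> /= /val_inj ->.
  + by move/eqP; rewrite (negPf (neq_core a j)).
  + by move/eqP; rewrite (negPf (core_neq a)).
  + by move/esym/eqP; rewrite (negPf (neq_core b i)).
  + by move=> /= /enum_val_inj/cast_ord_inj ->.
  + by move/eqP; rewrite (negPf (iso_neq i)).
  + by move/esym/eqP; rewrite (negPf (core_neq b)).
  + by move/esym/eqP; rewrite (negPf (iso_neq j)).
- by rewrite cardG card_ext.
Qed.

Theorem theorem3p6 (n : nat) (hn : 1 <= n) :
  exists f :
    iso_classes (fun G => unbalanced G /\ #|G| = n) ->
    iso_classes (fun G => (balanced G \/ unbalanced G) /\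
                          exists2 t : nat, 0 <= t <= n - 1 & #|G| = t),
    bijective f.
Proof.
(* With the universal vertex this makes [n] vertices; the truncated subtraction is exact because [H]
   has at most [n - 1] vertices. *)
apply: (@iso_classes_bij _ _ (fun H => ext H (n.-1 - #|H|))).
- move=> H [_ [t]]; rewrite subn1 => /= le_t cardH.
  split; first exact: ext_unbalanced.
  by rewrite card_ext cardH subnKC // prednK.
- have noQ (H : xygraph) : balanced H \/ unbalanced H -> no_isolates H.
    by case=> /andP[].
  move=> H K [/noQ noH _] [/noQ noK _]; split; first exact: ext_iso_inv.
  (* Isomorphic graphs have the same order, hence receive the same number of added isolates. *)
  by move=> isoHK; rewrite (xy_iso_card isoHK); apply: ext_iso.
- move=> G [/andP[_ /existsP[x ux]] cardG].
  have leC : #|induced (core x)| <= n.-1.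
    by rewrite -ltnS prednK // -cardG card_core_lt.
  exists (induced (core x)).
    split; last by exists #|induced (core x)|; rewrite ?subn1.
    (* The core has no isolates in Y, so it is balanced or unbalanced according to whether it has a
       universal vertex. *)
    rewrite /balanced /unbalanced core_no_isolates /=.
    by case: [exists _, _]; [right | left].
  by apply: ext_core_iso => //; rewrite subnKC // prednK.
Qed.
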